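(* Let $X\in\mathbb{R}^{m\times n}$ with $\mathrm{rank}(X)=n$, and let $k$ be a fixed integer with $0<k<n$. Let $X_k^*\in\mathbb{R}^{m\times k}$ be a column submatrix of $X$ that maximizes $\log\mathrm{vol}(B)$ among all column submatrices $B\in\mathbb{R}^{m\times k}$ of $X$. Then the output matrix $X_k\equiv X_{\mathcal{S}}$ of the Gu–Eisenstat QR column selection algorithm with relaxation factor $\eta=1$ satisfies $$0\le\log\mathrm{vol}(X_k^* )-\log\mathrm{vol}(X_k)\le\frac{k-1}{2k-1}\log\mathrm{vol}\bigl(X_k^*/\sigma_n(X)\bigr),$$ where $\frac{k-1}{2k-1}<\frac12$.
   Context: $\sigma_1(X)\ge\cdots\ge\sigma_n(X)$ are the singular values of $X$. For $\mathcal{S}\subset\{1,\ldots,n\}$, $X_{\mathcal{S}}$ is the submatrix of $X$ consisting of the columns indexed by $\mathcal{S}$. $\mathrm{vol}(B)=\sqrt{\det(B^TB)}$, the product of the singular values, for a matrix $B$ with full column rank; a matrix with linearly dependent columns has volume $0$. Gu–Eisenstat QR column selection. Input: $X\in\mathbb{R}^{m\times n}$, an integer $0<k\le\mathrm{rank}(X)$, a relaxation factor $\eta\ge1$. Start with any $\mathcal{S}\subset\{1,\ldots,n\}$ with $|\mathcal{S}|=k$ and $\mathrm{rank}(X_{\mathcal{S}})=k$. As long as there are $i\in\mathcal{S}$ and $j\in\{1,\ldots,n\}-\mathcal{S}$ such that $\mathcal{T}=(\mathcal{S}-\{i\})\cup\{j\}$ satisfies $\mathrm{vol}(X_{\mathcal{T}})>\eta\,\mathrm{vol}(X_{\mathcal{S}})$,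 replace $\mathcal{S}$ by such a $\mathcal{T}$. When no such swap exists, output the $m\times k$ column submatrix $X_{\mathcal{S}}$. *)

(* Defs.v *)
From HB Require Import structures.
From mathcomp Require Import all_boot all_order all_algebra.
From mathcomp Require Import polyrcf.
From mathcomp Require Import reals exp.

Set Implicit Arguments.
Unset Strict Implicit.
Unset Printing Implicit Defensive.

Import Order.TTheory GRing.Theory Num.Theory.
Local Open Scope ring_scope.

(* Square roots of the eigenvalues of X^T X, repeated according to their      *)
(* (algebraic) multiplicity, in nonincreasing order. There are n of them, the *)
(* number of columns, so zeros are included when n exceeds the rank.          *)
Definition singular_values (R : realType) (m n : nat) (X : 'M[R]_(m, n)) :
    seq R :=
  let p := char_poly (X^T *m X) in
  sort (fun a b : R => b <= a)
    (flatten [seq nseq (mup a p) (Num.sqrt a) | a <- rootsR p]).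

(* Indexed from 1: sigma X 1 is the largest singular value, sigma X n the     *)
(* smallest one.                                                              *)
Definition sigma (R : realType) (m n : nat) (X : 'M[R]_(m, n)) (i : nat) : R :=
  nth 0 (singular_values X) i.-1.

(* enum_val lists S in increasing order. *)
Definition colsubset (R : realType) (m n : nat) (X : 'M[R]_(m, n))
    (S : {set 'I_n}) : 'M[R]_(m, #|S|) :=
  colsub (fun j : 'I_#|S| => enum_val j) X.

Definition vol (R : realType) (m k : nat) (B : 'M[R]_(m, k)) : R :=
  Num.sqrt (\det (B^T *m B)).

Definition ge_swap (R : realType) (m n : nat) (X : 'M[R]_(m, n)) (eta : R) :
    rel {set 'I_n} := fun S T =>
  [exists i in S, [exists j in ~: S, (T == j |: (S :\ i)) &&
    (vol (colsubset X T) > eta * vol (colsubset X S))]].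

(* The algorithm is nondeterministic (choice of the initial set and of each   *)
(* swap); this holds of every index set at which some run can stop.           *)
Definition ge_output (R : realType) (m n : nat) (X : 'M[R]_(m, n)) (k : nat)
    (eta : R) (S : {set 'I_n}) : Prop :=
  (exists S0 : {set 'I_n},
     [/\ #|S0| = k, \rank (colsubset X S0) = k
       & connect (ge_swap X eta) S0 S]) /\
  (forall T : {set 'I_n}, ~~ ge_swap X eta S T).

(* Main.v *)
Require Import Defs.
From HB Require Import structures.
From mathcomp Require Import all_boot all_order all_algebra perm.
From mathcomp Require Import ring lra.
From mathcomp Require Import polyrcf complex.
From mathcomp Require Import reals exp.

(** Write sigma for the smallest singular value of X and give each set A of
    columns the weight f(A) = ln (vol X_A) - |A| ln sigma.  The bound is the
    classical guarantee for swap-optimal sets of a monotone submodular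
    function, applied to f.

    Adding a column j to A multiplies the volume by the distance from that
    column to the span of the columns in A ([vol_setU1]), so the increment of f
    is ln (distance) - ln sigma.  A larger A has a larger span, hence a smaller
    distance: f is submodular.  The vector realising the distance is X w with
    w_j = 1, so its norm is at least sigma: f is nondecreasing.  Moreover
    f(empty set) = 0.

    Let S be a set of k columns that no swap improves, U any set of at most k
    columns, i in S, and d_i = f(S) - f(S - i) >= 0.  Since S is swap-optimal,
    each column raises f(S - i) by at most d_i, and submodularity gives

      f(U) <= f((S - i) + U) <= f(S - i) + k d_i = f(S) + (k - 1) d_i.

    Again by submodularity the d_i add up to at most f(S).  Summing the display
    over i in S gives k f(U) <= (2 k - 1) f(S) ([swap_optimal_bound]), and for
    U the optimal set this is a rearrangement of the claim, because
    f(U) = ln (vol (X_U / sigma)).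

    The inequality sigma |v| <= |X v| comes from the spectral theorem for the
    real symmetric matrix X^T X.  Singular values being square roots of roots
    of its characteristic polynomial, that polynomial also has to be shown to
    split over the reals, which makes sigma, the n-th singular value, the
    square root of the smallest eigenvalue. *)

Import Order.TTheory GRing.Theory Num.Theory.
Local Open Scope ring_scope.

Set Implicit Arguments.
Unset Strict Implicit.
Unset Printing Implicit Defensive.

(** * Swap-optimal sets of a submodular function *)

Lemma nondecreasing_setU (R : numDomainType) (T : finType)
    (f : {set T} -> R) (f_mono : forall A j, f A <= f (j |: A))
    (A B : {set T}) : f A <= f (A :|: B).
Proof.
rewrite -[B]set_enum; elim: (enum B) => [|j s IHs].
  by rewrite set_nil setU0.
by rewrite set_cons setUCA; exact: le_trans IHs (f_mono _ _).
Qed.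

(** Adding the elements of [B] one after the other, each step gains no more
    than adding the same element directly to [A] would. *)
Lemma submodular_setU_le (R : numDomainType) (T : finType)
    (f : {set T} -> R) (f_mono : forall A j, f A <= f (j |: A))
    (f_sub : forall (A B : {set T}) (j : T), A \subset B -> j \notin B ->
       f (j |: B) - f B <= f (j |: A) - f A)
    (A B : {set T}) (c : R) :
  (forall j, j \in B -> f (j |: A) - f A <= c) ->
  f (A :|: B) <= f A + #|B|%:R * c.
Proof.
rewrite cardE -{1 2}[B]set_enum; elim: (enum B) => [|j s IHs] cP.
  by rewrite set_nil setU0 mul0r addr0.
have {}IHs : f (A :|: [set:: s]) <= f A + (size s)%:R * c.
  by apply: IHs => i; rewrite inE => si; rewrite cP // !inE si orbT.
have jc : f (j |: A) - f A <= c by apply: cP; rewrite inE mem_head.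
rewrite set_cons setUCA /= -natr1 mulrDl mul1r addrA.
apply: le_trans (lerD IHs jc); rewrite addrC -lerBlDr.
have [jAs|jAs] := boolP (j \in A :|: [set:: s]); last first.
  exact: f_sub (subsetUl _ _) jAs.
by rewrite (setUidPr _) ?sub1set // subrr subr_ge0.
Qed.

(** Building [S] up from the empty set, each step gains at least what the
    element is worth as the last one added, and the gains telescope. *)
Lemma submodular_sum_marginal_le (R : numDomainType) (T : finType)
    (f : {set T} -> R) (f0 : f set0 = 0)
    (f_sub : forall (A B : {set T}) (j : T), A \subset B -> j \notin B ->
       f (j |: B) - f B <= f (j |: A) - f A)
    (S : {set T}) : \sum_(i in S) (f S - f (S :\ i)) <= f S.
Proof.
suff sum_le s : uniq s -> {subset s <= S} ->
    \sum_(i <- s) (f S - f (S :\ i)) <= f [set:: s].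
  rewrite -big_enum; apply: le_trans (sum_le _ (enum_uniq _) _) _.
    by move=> i; rewrite mem_enum.
  by rewrite set_enum.
elim: s => [|i s IHs] /=; first by rewrite big_nil set_nil f0.
case/andP=> s'i uniq_s sub_S; rewrite big_cons set_cons.
have Si : i \in S by apply: sub_S; rewrite mem_head.
have sub_s : {subset s <= S} by move=> j sj; rewrite sub_S // inE sj orbT.
rewrite -[X in _ <= X](subrK (f [set:: s])) lerD ?IHs //.
rewrite -{1}(setD1K Si) f_sub ?setD11 //.
apply/subsetP=> j; rewrite !inE => sj; rewrite sub_s // andbT.
by apply: contraNneq s'i => <-.
Qed.

(** Passing from [S] to [U] through [S :\ i] first gives up the value that [i]
    adds and then gains at most [#|S|] times as much; this loss is what lowers
    the factor from [2] to [2 - 1 / k]. *)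
Lemma swap_optimal_bound (R : realDomainType) (T : finType)
    (f : {set T} -> R) (f0 : f set0 = 0)
    (f_mono : forall A j, f A <= f (j |: A))
    (f_sub : forall (A B : {set T}) (j : T), A \subset B -> j \notin B ->
       f (j |: B) - f B <= f (j |: A) - f A)
    (S U : {set T}) (U_le_S : (#|U| <= #|S|)%N)
    (S_opt : forall i j, i \in S -> j \notin S ->
       f (j |: (S :\ i)) <= f S) :
  #|S|%:R * f U <= (2 * #|S|%:R - 1) * f S.
Proof.
have d_ge0 i : i \in S -> 0 <= f S - f (S :\ i).
  by move=> Si; rewrite subr_ge0 -{2}(setD1K Si).
have le_i i : i \in S -> f U <= f S + (#|S|%:R - 1) * (f S - f (S :\ i)).
  move=> Si; apply: (@le_trans _ _ (f (S :\ i) + #|U|%:R * (f S - f (S :\ i)))).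
    apply: (le_trans (nondecreasing_setU f_mono U (S :\ i))).
    rewrite setUC; apply: submodular_setU_le => // j Uj.
    have [Sj|S'j] := boolP (j \in S); last by rewrite lerD2r S_opt.
    have [->|ne_ji] := eqVneq j i; first by rewrite setD1K.
    by rewrite (setUidPr _) ?sub1set ?inE ?ne_ji // subrr d_ge0.
  have: #|U|%:R * (f S - f (S :\ i)) <= #|S|%:R * (f S - f (S :\ i)).
    by rewrite ler_wpM2r ?d_ge0 // ler_nat.
  by lra.
have sum_le := submodular_sum_marginal_le f0 f_sub S.
have [->|/set0Pn[i0 Si0]] := eqVneq S set0.
  by rewrite cards0 f0 mul0r mulr0.
have card_ge1 : 1 <= #|S|%:R :> R by rewrite ler1n (cardD1 i0) Si0.
have: \sum_(i in S) f U
    <= \sum_(i in S) (f S + (#|S|%:R - 1) * (f S - f (S :\ i))).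
  exact: ler_sum le_i.
rewrite sumr_const big_split /= sumr_const -mulr_sumr.
rewrite -[f U *+ _]mulr_natl -[f S *+ _]mulr_natl.
move/le_trans; apply; rewrite -subr_ge0 in card_ge1.
by have := ler_wpM2l card_ge1 sum_le; lra.
Qed.

(** * Gram determinants and distances to column spans *)

Definition gram (R : pzRingType) (m n : nat) (X : 'M[R]_(m, n)) : 'M[R]_n :=
  X^T *m X.

Definition sqnorm (R : pzRingType) (n : nat) (u : 'cV[R]_n) : R :=
  gram u 0 0.

Lemma sqnormE (R : pzRingType) (n : nat) (u : 'cV[R]_n) :
  sqnorm u = \sum_i u i 0 ^+ 2.
Proof. by rewrite /sqnorm mxE; apply: eq_bigr => i _; rewrite mxE expr2. Qed.

Lemma sqnorm_ge0 (R : realDomainType) (n : nat) (u : 'cV[R]_n) :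
  0 <= sqnorm u.
Proof. by rewrite sqnormE sumr_ge0 // => i _; rewrite sqr_ge0. Qed.

Lemma sqnorm_gt0 (R : realDomainType) (n : nat) (u : 'cV[R]_n) :
  u != 0 -> 0 < sqnorm u.
Proof.
move=> u_neq0; rewrite lt_neqAle sqnorm_ge0 andbT eq_sym.
apply: contra u_neq0; rewrite sqnormE psumr_eq0 => [/allP u0|i _]; last first.
  exact: sqr_ge0.
apply/eqP/colP=> i; rewrite mxE; apply/eqP.
by have := u0 i (mem_index_enum _); rewrite sqrf_eq0.
Qed.

Lemma sqnorm_orthoD (R : comPzRingType) (n : nat) (u v : 'cV[R]_n) :
  u^T *m v = 0 -> sqnorm (u + v) = sqnorm u + sqnorm v.
Proof.
move=> uv0; have vu0 : v^T *m u = 0.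
  by rewrite -[LHS]trmxK trmx_mul trmxK uv0 trmx0.
rewrite /sqnorm /gram [(u + v)^T]linearD /= mulmxDl !mulmxDr uv0.
by rewrite vu0 addr0 add0r mxE.
Qed.

Lemma det_gram_row_mx_ortho (R : comNzRingType) (m p : nat) (r : 'cV[R]_m)
    (Y : 'M[R]_(m, p)) :
  r^T *m Y = 0 -> \det (gram (row_mx r Y)) = sqnorm r * \det (gram Y).
Proof.
move=> rY0; have Yr0 : Y^T *m r = 0.
  by rewrite -[LHS]trmxK trmx_mul trmxK rY0 trmx0.
by rewrite /gram tr_row_mx mul_col_row rY0 Yr0 det_ublock det_mx11.
Qed.

(** The minimiser [c] solves the normal equations; subtracting [Y *m c] from [x]
    is a unimodular column operation which makes the first column orthogonal to
    the others. *)
Lemma det_gram_row_mx (R : realFieldType) (m p : nat) (x : 'cV[R]_m)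
    (Y : 'M[R]_(m, p)) :
  \det (gram Y) != 0 ->
  exists c : 'cV_p,
    \det (gram (row_mx x Y)) = sqnorm (x - Y *m c) * \det (gram Y)
    /\ forall c', sqnorm (x - Y *m c) <= sqnorm (x - Y *m c').
Proof.
move=> detY; have unitG : gram Y \in unitmx by rewrite unitmxE unitfE.
pose c := invmx (gram Y) *m (Y^T *m x); exists c.
pose r : 'cV[R]_m := x - Y *m c; rewrite -/r.
have Yr0 : Y^T *m r = 0.
  by rewrite mulmxBr mulmxA -/(gram Y) mulKVmx // subrr.
have rY0 : r^T *m Y = 0 by rewrite -[LHS]trmxK trmx_mul trmxK Yr0 trmx0.
split=> [|c'].
  have -> : row_mx x Y = row_mx r Y *m block_mx 1%:M 0 c 1%:M.
    by rewrite mul_row_block mulmx0 add0r !mulmx1 subrK.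
  rewrite -det_gram_row_mx_ortho // /gram trmx_mul mulmxA.
  rewrite -[_^T *m _ *m _]mulmxA !det_mulmx det_tr det_lblock !det1 mulr1.
  by rewrite mul1r mulr1.
have -> : x - Y *m c' = r + Y *m (c - c').
  by rewrite mulmxBr addrA subrK.
have r_ortho : r^T *m (Y *m (c - c')) = 0 by rewrite mulmxA rY0 mul0mx.
by rewrite (sqnorm_orthoD r_ortho) lerDl sqnorm_ge0.
Qed.

(** Two enumerations of the same columns differ by a permutation, whose sign
    enters the Gram determinant squared. *)
Lemma det_gram_colsub (R : realType) (m n p : nat) (X : 'M[R]_(m, n))
    (A : {set 'I_n}) (f : 'I_p -> 'I_n) :
  injective f -> f @: 'I_p = A ->
  \det (gram (colsub f X)) = \det (gram (colsubset X A)).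
Proof.
move=> f_inj fA; have pA : #|A| = p by rewrite -fA card_imset ?card_ord.
subst p; have Af i : f i \in A by rewrite -fA imset_f.
pose s i := enum_rank_in (Af i) (f i).
have sK i : enum_val (s i) = f i by rewrite enum_rankK_in.
have s_inj : injective s by move=> i j sij; apply: f_inj; rewrite -!sK sij.
have -> : colsub f X = colsubset X A *m perm_mx (perm s_inj)^-1.
  rewrite -col_permE; apply/matrixP=> i j; rewrite !mxE permE.
  by congr (X i _); rewrite sK.
rewrite /gram trmx_mul mulmxA -[_^T *m _ *m _]mulmxA !det_mulmx det_tr det_perm.
by rewrite mulrAC -expr2 sqrr_sign mul1r.
Qed.

(** Coefficient vectors indexed by all the columns, so that those attached to
    different sets [A] can be compared without reindexing. *)
Definition supported (R : pzRingType) (n : nat) (A : {set 'I_n})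
  (v : 'cV[R]_n) : Prop := forall i, i \notin A -> v i 0 = 0.

Lemma supported_colsubP (R : realType) (m n : nat) (X : 'M[R]_(m, n))
    (A : {set 'I_n}) (y : 'cV[R]_m) :
  (exists c, y = colsubset X A *m c) <->
  (exists2 v : 'cV_n, supported A v & y = X *m v).
Proof.
pose E := colsubset (1%:M : 'M[R]_n) A.
have -> : colsubset X A = X *m E by rewrite /E /colsubset mulmx_colsub mulmx1.
split=> [[c ->]|[v vA ->]].
  exists (E *m c); last by rewrite mulmxA.
  move=> i A'i; rewrite mxE big1 // => j _; rewrite !mxE.
  by case: eqP A'i => [->|_]; rewrite ?enum_valP ?mul0r.
exists (\col_l v (enum_val l) 0); rewrite -mulmxA; congr (X *m _).
apply/colP=> i; rewrite mxE.
have [Ai|A'i] := boolP (i \in A); last first.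
  rewrite vA // big1 // => j _; rewrite !mxE.
  by case: eqP A'i => [->|_]; rewrite ?enum_valP ?mul0r.
rewrite (bigD1 (enum_rank_in Ai i)) //= !mxE enum_rankK_in // eqxx mul1r.
rewrite big1 ?addr0 // => j ne_j; rewrite !mxE.
case: eqP => [iE|_]; last by rewrite /= mul0r.
by case/eqP: ne_j; apply: enum_val_inj; rewrite enum_rankK_in.
Qed.

(** The column [j] is inserted in front of the enumeration of [A], whatever its
    place in the increasing enumeration of [j |: A]. *)
Lemma det_gram_setU1 (R : realType) (m n : nat) (X : 'M[R]_(m, n))
    (A : {set 'I_n}) (j : 'I_n) :
  j \notin A -> \det (gram (colsubset X A)) != 0 ->
  exists2 v : 'cV_n, supported A v &
    \det (gram (colsubset X (j |: A)))
      = sqnorm (col j X - X *m v) * \det (gram (colsubset X A))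
    /\ forall w, supported A w ->
         sqnorm (col j X - X *m v) <= sqnorm (col j X - X *m w).
Proof.
move=> A'j /(det_gram_row_mx (col j X))[c [detE c_min]].
have [|v vA vE] := (supported_colsubP X A (colsubset X A *m c)).1.
  by exists c.
exists v => //; rewrite -vE; split=> [|w wA]; last first.
  have [|c' ->] := (supported_colsubP X A (X *m w)).2; first by exists w.
  exact: c_min.
rewrite -detE; symmetry.
pose f (l : 'I_(1 + #|A|)) : 'I_n :=
  match split l with inl _ => j | inr a => enum_val a end.
have -> : row_mx (col j X) (colsubset X A) = colsub f X.
  by apply/matrixP=> a b; rewrite !mxE /f; case: split => b'; rewrite mxE.
apply: det_gram_colsub => [a b|].
  rewrite /f; case: (splitP a) => a' Ea; case: (splitP b) => b' Eb.
  - by move=> _; apply/val_inj; rewrite /= Ea Eb !ord1.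
  - by move=> jE; case/negP: A'j; rewrite jE enum_valP.
  - by move=> jE; case/negP: A'j; rewrite -jE enum_valP.
  by move/enum_val_inj=> ab; apply/val_inj; rewrite /= Ea Eb ab.
apply/setP=> i; rewrite !inE; apply/imsetP/orP => [[l _ ->]|[/eqP->|Ai]].
- rewrite /f; case: split => a; [by left; rewrite eqxx|].
  by right; rewrite enum_valP.
- exists (lshift _ 0) => //; rewrite /f; case: splitP => // a /= Ea.
exists (rshift 1 (enum_rank_in Ai i)) => //.
rewrite /f -[rshift _ _]/(unsplit (inr _)) unsplitK /=.
by rewrite enum_rankK_in.
Qed.

(** * Spectrum of a real symmetric matrix *)

Local Open Scope sesquilinear_scope.

Lemma det_conj (R : comPzRingType) (n : nat) (P Q M : 'M[R]_n) :
  Q *m P = 1%:M -> \det (Q *m M *m P) = \det M.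
Proof. by move=> QP; rewrite !det_mulmx mulrAC -det_mulmx QP det1 mul1r. Qed.

Lemma conj_scalar_mxB (R : comPzRingType) (n : nat) (P Q M : 'M[R]_n) (a : R) :
  Q *m P = 1%:M -> Q *m (a%:M - M) *m P = a%:M - Q *m M *m P.
Proof.
by move=> QP; rewrite mulmxBr mulmxBl scalar_mxC -(mulmxA _%:M) QP mulmx1.
Qed.

Lemma char_poly_conj_diag (R : comNzRingType) (n : nat) (P Q : 'M[R]_n)
    (d : 'rV[R]_n) : Q *m P = 1%:M ->
  char_poly (Q *m diag_mx d *m P) = \prod_i ('X - (d 0 i)%:P).
Proof.
move=> QP; have QPp : map_mx polyC Q *m map_mx polyC P = 1%:M.
  by rewrite -map_mxM QP map_mx1.
have -> : char_poly (Q *m diag_mx d *m P) = char_poly (diag_mx d).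
  rewrite -[RHS](det_conj _ QPp) /char_poly /char_poly_mx !map_mxM /=.
  by congr determinant; symmetry; apply: conj_scalar_mxB.
rewrite char_poly_trig ?diag_mx_is_trig //.
by apply: eq_bigr => i _; rewrite mxE eqxx mulr1n.
Qed.

(** Over [R[i]] the matrix is Hermitian, hence unitarily diagonalisable with
    real eigenvalues.  Both conclusions descend to [R]: the characteristic
    polynomial because the embedding of polynomials is injective, the lower
    bound on the quadratic form because it is a comparison of real numbers in
    eigenvector coordinates. *)
Lemma symmetric_real_spectrum (R : rcfType) (n : nat) (G : 'M[R]_n) :
  G^T = G ->
  exists d : 'rV[R]_n, char_poly G = \prod_i ('X - (d 0 i)%:P)
    /\ forall (c : R) (v : 'cV_n), (forall i, c <= d 0 i) ->
         c * sqnorm v <= (v^T *m G *m v) 0 0.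
Proof.
move=> Gsym; pose toC : {rmorphism R -> R[i]} := real_complex R.
pose GC := map_mx toC G.
have toC_real x : toC x \is Num.real by apply/complex_realP; exists x.
have GCh : GC \is hermsymmx.
  apply: realsym_hermsym; last by apply/mxOverP=> i j; rewrite mxE.
  apply/is_hermitianmxP; rewrite expr0 scale1r map_mx_id //.
  by rewrite /GC map_trmx Gsym.
have /hermitian_spectral_diag_real/mxOverP dR := GCh.
have /hermitian_normalmx/orthomx_spectralP := GCh.
set P := spectralmx GC; set dC := spectral_diag GC in dR *.
have Pu : P \in unitmx := spectral_unit GC.
have PV : invmx P = P^t Num.conj by rewrite invmx_unitary ?spectral_unitarymx.
move=> GCE; pose d := \row_i complex.Re (dC 0 i).
have dE i : dC 0 i = toC (d 0 i) by rewrite mxE /toC /= RRe_real.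
exists d; split=> [|c v c_le].
  apply: (map_poly_inj toC); rewrite map_char_poly -/GC GCE.
  rewrite char_poly_conj_diag ?mulVmx // rmorph_prod /=.
  by apply: eq_bigr => i _; rewrite dE rmorphB /= map_polyX map_polyC.
(* [w] holds the coordinates of [v] in the eigenbasis. *)
pose vC := map_mx toC v; pose w := P *m vC.
have vCE : map_mx toC v^T = vC^t Num.conj.
  by apply/matrixP=> i j; rewrite !mxE; symmetry; apply/CrealP.
have wE : w^t Num.conj = vC^t Num.conj *m invmx P.
  by rewrite PV trmx_mul map_mxM.
suff: toC (c * sqnorm v) <= toC ((v^T *m G *m v) 0 0) by rewrite lecR.
rewrite rmorphM /=.
have -> : toC (sqnorm v) = \sum_i `|w i 0| ^+ 2.
  transitivity ((w^t Num.conj *m w) 0 0).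
    by rewrite wE -mulmxA mulKmx // -vCE -map_mxM /sqnorm /gram !mxE.
  by rewrite mxE; apply: eq_bigr => i _; rewrite 2!mxE normCK mulrC.
have -> : toC ((v^T *m G *m v) 0 0) = \sum_i dC 0 i * `|w i 0| ^+ 2.
  transitivity ((w^t Num.conj *m diag_mx dC *m w) 0 0).
    rewrite wE -!mulmxA !(mulmxA (invmx P)) (mulmxA _ P) -GCE -vCE.
    by rewrite -!map_mxM !mxE.
  rewrite mul_mx_diag mxE; apply: eq_bigr => i _; rewrite !mxE normCK.
  by rewrite mulrAC mulrC; congr (_ * _); rewrite mulrC.
rewrite mulr_sumr ler_sum // => i _; rewrite ler_wpM2r ?exprn_ge0 //.
by rewrite dE lecR.
Qed.

Local Close Scope sesquilinear_scope.

(** * The smallest singular value *)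

Lemma rootsR_prod_XsubC (R : rcfType) (s : seq R) :
  perm_eq (rootsR (\prod_(a <- s) ('X - a%:P))) (undup s).
Proof.
have p_neq0 : \prod_(a <- s) ('X - a%:P) != 0.
  by rewrite monic_neq0 ?monic_prod_XsubC.
apply: uniq_perm; rewrite ?uniq_roots ?undup_uniq // => a.
by rewrite -roots_on_rootsR // itv_boundlr /= root_prod_XsubC mem_undup.
Qed.

(** Repeating each root according to its multiplicity gives back the list of
    linear factors up to order. *)
Lemma singular_values_perm (R : realType) (m n : nat) (X : 'M[R]_(m, n))
    (s : seq R) :
  char_poly (gram X) = \prod_(a <- s) ('X - a%:P) ->
  perm_eq (singular_values X) (map Num.sqrt s).
Proof.
rewrite /singular_values -/(gram X) => ->; rewrite perm_sort.
under eq_map do rewrite mu_prod_XsubC -map_nseq.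
rewrite map_comp -map_flatten perm_map //.
rewrite -(permPr (perm_count_undup s)) perm_flatten // perm_map //.
exact: rootsR_prod_XsubC.
Qed.

Lemma sqnorm_mulmx (R : comPzRingType) (m n : nat) (X : 'M[R]_(m, n))
    (v : 'cV[R]_n) : sqnorm (X *m v) = (v^T *m gram X *m v) 0 0.
Proof. by rewrite /sqnorm /gram trmx_mul !mulmxA. Qed.

(** An eigenvector [v] for [a] satisfies [|X v|^2 = a |v|^2], and [X v] is
    nonzero because the columns of [X] are independent. *)
Lemma root_char_poly_gram_gt0 (R : realFieldType) (m n : nat)
    (X : 'M[R]_(m, n)) (a : R) :
  \rank X = n -> root (char_poly (gram X)) a -> 0 < a.
Proof.
move=> rkX; rewrite -eigenvalue_root_char => /eigenvalueP[v vG v_neq0].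
have Xv : sqnorm (X *m v^T) = a * sqnorm v^T.
  by rewrite sqnorm_mulmx trmxK vG -scalemxAl mxE /sqnorm /gram trmxK.
have v_gt0 : 0 < sqnorm v^T.
  by rewrite sqnorm_gt0 // -(inj_eq trmx_inj) trmxK trmx0.
rewrite -(pmulr_lgt0 _ v_gt0) -Xv sqnorm_gt0 //.
apply: contra v_neq0 => /eqP/(congr1 trmx).
rewrite trmx_mul trmxK trmx0 => vX0.
have free : row_free X^T by rewrite /row_free mxrank_tr rkX.
by apply/eqP/(row_free_inj free); rewrite mul0mx.
Qed.

(** There are exactly [n] singular values, so [sigma X n] is the last entry of
    the sorted list: the square root of the least eigenvalue of the Gram
    matrix. *)
Lemma sigma_last_le (R : realType) (m n : nat) (X : 'M[R]_(m, n)) :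
  \rank X = n -> (0 < n)%N ->
  0 < sigma X n
  /\ forall v : 'cV_n, sigma X n ^+ 2 * sqnorm v <= sqnorm (X *m v).
Proof.
move=> rkX n_gt0.
have [|d [charG rayleigh]] := @symmetric_real_spectrum R n (gram X).
  by rewrite /gram trmx_mul trmxK.
pose s := [seq d 0 i | i <- enum 'I_n].
have charGs : char_poly (gram X) = \prod_(a <- s) ('X - a%:P).
  by rewrite charG /s big_map big_enum.
have d_gt0 i : 0 < d 0 i.
  apply: (root_char_poly_gram_gt0 rkX); rewrite charGs root_prod_XsubC.
  by rewrite map_f ?mem_enum.
have perm_sv := singular_values_perm charGs.
have size_sv : size (singular_values X) = n.
  by rewrite (perm_size perm_sv) size_map [size s]size_map size_enum_ord.
have: sigma X n \in singular_values X.
  by rewrite mem_nth // size_sv prednK.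
rewrite (perm_mem perm_sv) => /mapP[a /mapP[i _ ->] sigmaE].
have sigma_gt0 : 0 < sigma X n by rewrite sigmaE sqrtr_gt0.
split=> // v; rewrite sqnorm_mulmx; apply: rayleigh => j.
rewrite -(sqr_sqrtr (ltW (d_gt0 j))).
rewrite ler_pXn2r ?nnegrE ?sqrtr_ge0 ?(ltW sigma_gt0) //.
have sv_j : Num.sqrt (d 0 j) \in singular_values X.
  by rewrite (perm_mem perm_sv) !map_f ?mem_enum.
rewrite -(nth_index 0 sv_j) /sigma.
have ge_trans : transitive (fun a b : R => b <= a).
  by move=> y x z yx zy; exact: le_trans zy yx.
have sorted_sv : sorted (fun a b : R => b <= a) (singular_values X).
  by apply: sort_sorted => x y; exact: le_total.
have idx_lt : (index (Num.sqrt (d 0%R j)) (singular_values X) < n)%N.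
  by rewrite -[ltnRHS]size_sv index_mem.
have := sorted_leq_nth ge_trans (fun a => lexx a) 0 sorted_sv
  (index (Num.sqrt (d 0 j)) (singular_values X)) n.-1.
by apply; rewrite ?inE ?size_sv ?prednK // -ltnS prednK.
Qed.

(** * Volumes of column submatrices *)

(** Its minimum over the [v] supported in [A] is the distance from column [j]
    to the span of the columns in [A]. *)
Definition coldist (R : realType) (m n : nat) (X : 'M[R]_(m, n)) (j : 'I_n)
  (v : 'cV[R]_n) : R := Num.sqrt (sqnorm (col j X - X *m v)).

(** The vector in question is [X w] where [w] has entry [1] at [j], because [v]
    vanishes there. *)
Lemma sigma_le_coldist (R : realType) (m n : nat) (X : 'M[R]_(m, n))
    (A : {set 'I_n}) (j : 'I_n) (v : 'cV_n) :
  \rank X = n -> j \notin A -> supported A v -> sigma X n <= coldist X j v.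
Proof.
move=> rkX A'j vA.
have n_gt0 : (0 < n)%N := leq_trans (ltn0Sn j) (ltn_ord j).
have [sigma_gt0 sigma_le] := sigma_last_le rkX n_gt0.
have -> : sigma X n = Num.sqrt (sigma X n ^+ 2).
  by rewrite sqrtr_sqr gtr0_norm.
rewrite ler_wsqrtr //.
have -> : col j X - X *m v = X *m (delta_mx j 0 - v).
  by rewrite mulmxBr colE.
(* The entry at [j] alone contributes 1 to the squared norm. *)
apply: le_trans (sigma_le _); rewrite ler_peMr ?sqr_ge0 // sqnormE.
rewrite (bigD1 j) //= !mxE !eqxx vA // subr0 expr1n lerDl.
by rewrite sumr_ge0 // => i _; rewrite sqr_ge0.
Qed.

Lemma vol_set0 (R : realType) (m n : nat) (X : 'M[R]_(m, n)) :
  vol (colsubset X set0) = 1.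
Proof.
rewrite /vol; move: (colsubset X set0); rewrite cards0 => B.
by rewrite det_mx00 sqrtr1.
Qed.

Lemma volZ (R : realType) (m k : nat) (a : R) (B : 'M[R]_(m, k)) :
  0 <= a -> vol (a *: B) = a ^+ k * vol B.
Proof.
move=> a_ge0; rewrite /vol [(a *: B)^T]linearZ /= -scalemxAl -scalemxAr.
rewrite !detZ mulrA -expr2.
by rewrite sqrtrM ?sqr_ge0 // sqrtr_sqr ger0_norm ?exprn_ge0.
Qed.

(** The volume of a parallelepiped is base times height. *)
Lemma vol_setU1 (R : realType) (m n : nat) (X : 'M[R]_(m, n))
    (A : {set 'I_n}) (j : 'I_n) :
  j \notin A -> 0 < vol (colsubset X A) ->
  exists2 v : 'cV_n, supported A v &
    vol (colsubset X (j |: A)) = coldist X j v * vol (colsubset X A)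
    /\ forall w, supported A w -> coldist X j v <= coldist X j w.
Proof.
rewrite {1}/vol sqrtr_gt0 => A'j det_gt0.
have [v vA [detE v_min]] := det_gram_setU1 A'j (lt0r_neq0 det_gt0).
exists v => //; split=> [|w wA]; last by rewrite ler_wsqrtr // v_min.
by rewrite /vol [X in Num.sqrt X]detE sqrtrM ?sqnorm_ge0.
Qed.

Lemma vol_gt0 (R : realType) (m n : nat) (X : 'M[R]_(m, n))
    (A : {set 'I_n}) :
  \rank X = n -> (0 < n)%N -> 0 < vol (colsubset X A).
Proof.
move=> rkX n_gt0; rewrite -[A]set_enum.
elim: (enum A) => [|j s IHs]; first by rewrite set_nil vol_set0.
rewrite set_cons; have [js|js] := boolP (j \in [set:: s]).
  by rewrite (setUidPr _) ?sub1set.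
have [v vs [-> _]] := vol_setU1 js IHs; rewrite mulr_gt0 //.
apply: lt_le_trans (sigma_le_coldist rkX js vs).
by case: (sigma_last_le rkX n_gt0).
Qed.

(** * The normalised log-volume is monotone and submodular *)

(** The logarithm of the volume of the columns of [X / sigma_n(X)] in [A].
    Without this scaling the increments could be negative. *)
Definition normalized_logvol (R : realType) (m n : nat) (X : 'M[R]_(m, n))
  (A : {set 'I_n}) : R := ln (vol (colsubset X A)) - #|A|%:R * ln (sigma X n).

Lemma normalized_logvol_set0 (R : realType) (m n : nat) (X : 'M[R]_(m, n)) :
  normalized_logvol X set0 = 0.
Proof. by rewrite /normalized_logvol vol_set0 ln1 cards0 mul0r subrr. Qed.

Lemma normalized_logvol_setU1 (R : realType) (m n : nat) (X : 'M[R]_(m, n))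
    (A : {set 'I_n}) (j : 'I_n) :
  \rank X = n -> j \notin A ->
  exists2 v : 'cV_n, supported A v &
    normalized_logvol X (j |: A) - normalized_logvol X A
      = ln (coldist X j v) - ln (sigma X n)
    /\ forall w, supported A w -> ln (coldist X j v) <= ln (coldist X j w).
Proof.
move=> rkX A'j; have n_gt0 : (0 < n)%N := leq_trans (ltn0Sn j) (ltn_ord j).
have sigma_gt0 := (sigma_last_le rkX n_gt0).1.
have volA := vol_gt0 A rkX n_gt0.
have dist_pos w : supported A w -> coldist X j w \is Num.pos.
  move=> wA; rewrite posrE.
  exact: lt_le_trans sigma_gt0 (sigma_le_coldist rkX A'j wA).
have [v vA [volE v_min]] := vol_setU1 A'j volA.
exists v => //; split=> [|w wA]; last by rewrite ler_ln ?dist_pos ?v_min.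
rewrite /normalized_logvol volE lnM ?dist_pos // cardsU1 A'j add1n -natr1.
by ring.
Qed.

Lemma normalized_logvol_mono (R : realType) (m n : nat) (X : 'M[R]_(m, n))
    (A : {set 'I_n}) (j : 'I_n) :
  \rank X = n -> normalized_logvol X A <= normalized_logvol X (j |: A).
Proof.
move=> rkX; have [Aj|A'j] := boolP (j \in A).
  by rewrite (setUidPr _) ?sub1set.
have n_gt0 : (0 < n)%N := leq_trans (ltn0Sn j) (ltn_ord j).
have sigma_gt0 := (sigma_last_le rkX n_gt0).1.
have [v vA [stepE _]] := normalized_logvol_setU1 rkX A'j.
have sigma_le := sigma_le_coldist rkX A'j vA.
by rewrite -subr_ge0 stepE subr_ge0 ler_ln ?posrE ?(lt_le_trans sigma_gt0).
Qed.

Lemma normalized_logvol_submodular (R : realType) (m n : nat)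
    (X : 'M[R]_(m, n)) (A B : {set 'I_n}) (j : 'I_n) :
  \rank X = n -> A \subset B -> j \notin B ->
  normalized_logvol X (j |: B) - normalized_logvol X B
    <= normalized_logvol X (j |: A) - normalized_logvol X A.
Proof.
move=> rkX AB B'j.
have A'j : j \notin A by apply: contra B'j => /(subsetP AB).
have [v vA [-> _]] := normalized_logvol_setU1 rkX A'j.
have [w wB [-> w_min]] := normalized_logvol_setU1 rkX B'j.
rewrite lerD2r w_min // => i B'i; apply: vA.
by apply: contra B'i => /(subsetP AB).
Qed.

(** * Outputs of the column selection algorithm *)

Lemma ge_swapP (R : realType) (m n : nat) (X : 'M[R]_(m, n)) (eta : R)
    (S T : {set 'I_n}) :
  reflect (exists i j, [/\ i \in S, j \notin S, T = j |: (S :\ i)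
             & eta * vol (colsubset X S) < vol (colsubset X T)])
          (ge_swap X eta S T).
Proof.
apply: (iffP exists_inP) => [[i Si /exists_inP[j]]|[i [j [Si S'j TE lt_vol]]]].
  by rewrite inE => S'j /andP[/eqP TE lt_vol]; exists i, j.
exists i => //; apply/exists_inP; exists j; first by rewrite inE.
by rewrite -TE eqxx.
Qed.

Lemma card_swap (T : finType) (S : {set T}) (i j : T) :
  i \in S -> j \notin S -> #|j |: (S :\ i)| = #|S|.
Proof.
move=> Si S'j; rewrite cardsU1 in_setD1 (negPf S'j) andbF /=.
by rewrite [RHS](cardsD1 i) Si.
Qed.

Lemma card_connect_ge_swap (R : realType) (m n : nat) (X : 'M[R]_(m, n))
    (eta : R) (S T : {set 'I_n}) :
  connect (ge_swap X eta) S T -> #|T| = #|S|.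
Proof.
case/connectP=> p; elim: p S => [|U p IHp] S /= => [_ -> //|].
case/andP=> /ge_swapP[i [j [Si S'j UE _]]] pathU lastT.
by rewrite (IHp U pathU lastT) UE card_swap.
Qed.

Unset Implicit Arguments.

Theorem corollary5p2 (R : realType) (m n k : nat) (X : 'M[R]_(m, n))
    (rankX : \rank X = n) (k_gt0 : (0 < k)%N) (k_lt_n : (k < n)%N)
    (Sstar : {set 'I_n}) (card_Sstar : #|Sstar| = k)
    (Sstar_max : forall T : {set 'I_n}, #|T| = k ->
       ln (vol (colsubset X T)) <= ln (vol (colsubset X Sstar)))
    (S : {set 'I_n}) (S_out : ge_output X k 1 S) :
  [/\ 0 <= ln (vol (colsubset X Sstar)) - ln (vol (colsubset X S)),
      ln (vol (colsubset X Sstar)) - ln (vol (colsubset X S))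
        <= (k%:R - 1) / (2 * k%:R - 1)
             * ln (vol ((sigma X n)^-1 *: colsubset X Sstar))
    & (k%:R - 1) / (2 * k%:R - 1) < 1 / 2 :> R].
Proof.
have n_gt0 : (0 < n)%N := ltn_trans k_gt0 k_lt_n.
have sigma_gt0 := (sigma_last_le rankX n_gt0).1.
have vol_pos A : 0 < vol (colsubset X A) := vol_gt0 A rankX n_gt0.
have [[S0 [card_S0 _ /card_connect_ge_swap]]] := S_out.
rewrite card_S0 => card_S no_swap.
have k_ge1 : 1 <= k%:R :> R by rewrite ler1n.
have S_opt i j : i \in S -> j \notin S ->
    normalized_logvol X (j |: (S :\ i)) <= normalized_logvol X S.
  move=> Si S'j; rewrite /normalized_logvol.
  rewrite [X in _ - X%:R * _ <= _](card_swap Si S'j) lerD2r.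
  rewrite ler_ln ?posrE ?vol_pos // leNgt.
  apply: contra (no_swap (j |: (S :\ i))) => lt_vol.
  by apply/ge_swapP; exists i, j; rewrite mul1r.
have le_card : (#|Sstar| <= #|S|)%N by rewrite card_Sstar card_S.
have bound : k%:R * normalized_logvol X Sstar
    <= (2 * k%:R - 1) * normalized_logvol X S.
  rewrite -card_S; apply: (swap_optimal_bound (f := normalized_logvol X)) => //.
  - exact: normalized_logvol_set0.
  - by move=> A j; exact: normalized_logvol_mono.
  - by move=> A B j; exact: normalized_logvol_submodular.
have denom_gt0 : 0 < 2 * k%:R - 1 :> R by lra.
split.
- by rewrite subr_ge0 Sstar_max.
- have -> : ln (vol ((sigma X n)^-1 *: colsubset X Sstar))
      = normalized_logvol X Sstar.
    rewrite volZ ?invr_ge0 ?ltW // lnM ?posrE ?exprn_gt0 ?invr_gt0 //.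
    rewrite lnXn ?invr_gt0 // lnV ?posrE //.
    by rewrite /normalized_logvol -mulr_natl; ring.
  have -> : ln (vol (colsubset X Sstar)) - ln (vol (colsubset X S))
      = normalized_logvol X Sstar - normalized_logvol X S.
    by rewrite /normalized_logvol [X in _ = _ - X%:R * _ - _]card_Sstar
      [X in _ = _ - (_ - X%:R * _)]card_S; ring.
  rewrite mulrAC ler_pdivlMr //.
  by move: bound; lra.
by rewrite ltr_pdivrMr //; lra.
Qed.
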